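(* Let $B=B_{C_2}U(1)=\mathbb{CP}(\mathbb C^\infty\oplus(\mathbb C^\sigma)^\infty)$, let $K=K(2)$, and let $p:B\to K$ be the $C_2$-map (unique up to $C_2$-homotopy) sending $B^0$ to $K^0$ and $B^1$ to $K^1$. There is no equivariant section of $p$, even up to homotopy; that is, there is no $C_2$-map $s:K\to B$ such that $p\circ s$ is $C_2$-homotopic to the identity of $K$.
   Context: $C_2$ is the group of order 2; $\mathbb C$ is the trivial and $\mathbb C^\sigma$ the nontrivial one-dimensional complex representation of $C_2$. $B$ is the space of complex lines in $\mathbb C^\infty\oplus(\mathbb C^\sigma)^\infty$; its fixed set is $B^{C_2}=B^0\sqcup B^1$ with $B^0=\mathbb{CP}(\mathbb C^\infty)$ and $B^1=\mathbb{CP}((\mathbb C^\sigma)^\infty)$. $K=K(2)$ is a $C_2$-space of the homotopy type of a $C_2$-CW complex that is nonequivariantly contractible and whose fixed set $K^{C_2}=K^0\sqcup K^1$ consists of two contractible components $K^0$ and $K^1$; it is unique up to $C_2$-homotopy equivalence. *)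

(* Defs.v *)
From HB Require Import structures.
From mathcomp Require Import all_boot all_order all_algebra complex.
From mathcomp Require Import all_classical all_reals all_analysis.
Import numFieldNormedType.Exports.

Set Implicit Arguments.
Unset Strict Implicit.
Unset Printing Implicit Defensive.

Import Order.TTheory GRing.Theory Num.Theory.
Local Open Scope classical_set_scope.
Local Open Scope ring_scope.

(* A C_2-space is a space with the continuous involution by which the
   generator of C_2 acts. *)
HB.mixin Record isC2Space X & Topological X := {
  c2 : X -> X;
  c2_continuous : continuous c2;
  c2K : involutive c2
}.

#[short(type="c2SpaceType")]
HB.structure Definition C2Space := {X of isC2Space X & Topological X}.

Definition c2map (X Y : c2SpaceType) (f : X -> Y) : Prop :=
  continuous f /\ forall x, f (c2 x) = c2 (f x).

Definition fixset (X : c2SpaceType) : set X := [set x | c2 x = x].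
Arguments fixset : clear implicits.

Section homotopy.
Variable R : realType.

(* The values of H at times outside [0, 1] are irrelevant. *)
Definition is_homotopy (X Y : topologicalType) (f g : X -> Y)
    (H : X * R -> Y) : Prop :=
  [/\ {within [set z | 0 <= z.2 <= 1], continuous H},
      forall x, H (x, 0) = f x
    & forall x, H (x, 1) = g x].

Definition homotopic (X Y : topologicalType) (f g : X -> Y) : Prop :=
  exists H : X * R -> Y, is_homotopy f g H.

Definition c2homotopic (X Y : c2SpaceType) (f g : X -> Y) : Prop :=
  exists2 H : X * R -> Y, is_homotopy f g H
    & forall x t, 0 <= t <= 1 -> H (c2 x, t) = c2 (H (x, t)).

Definition c2homotopy_equivalent (X Y : c2SpaceType) : Prop :=
  exists (f : X -> Y) (g : Y -> X),
    [/\ c2map f, c2map g, c2homotopic (g \o f) idfun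
      & c2homotopic (f \o g) idfun].

Definition contractible (X : topologicalType) : Prop :=
  exists x0 : X, homotopic (@idfun X) (cst x0).

End homotopy.

HB.instance Definition _ := hasNbhs.Build unit principal_filter.
HB.instance Definition _ := Discrete_ofNbhs.Build unit erefl.

Lemma idfun_continuous (X : topologicalType) : continuous (@idfun X).
Proof. by move=> x; exact: cvg_id. Qed.

HB.instance Definition _ := isC2Space.Build unit
  (@idfun_continuous unit) (fun=> erefl).

Lemma negb_continuous : continuous negb.
Proof. by apply/continuousP => A _; exact: discrete_open. Qed.

HB.instance Definition _ := isC2Space.Build bool negb_continuous negbK.

(* The orbits C_2/C_2 (one fixed point) and C_2/e (two points swapped). *)
Definition orbit (fixed : bool) : c2SpaceType :=
  if fixed then (unit : c2SpaceType) else (bool : c2SpaceType).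

Section CW.
Variable R : realType.

Definition disc (n : nat) : set 'rV[R]_n :=
  [set x | \sum_i x ord0 i ^+ 2 <= 1].
Arguments disc : clear implicits.

Definition on_sphere (n : nat) (x : disc n) : Prop :=
  \sum_i (set_val x) ord0 i ^+ 2 = 1.

Definition rel_closed (X : topologicalType) (S A : set X) : Prop :=
  closed (set_val @^-1` A : set (set_type S)).

(* A C_2-CW structure: X is the colimit of an increasing sequence of skeleta,
   each with the subspace topology, and the n-skeleton is the pushout of
   skel (n - 1) <- \coprod_j G/H_j x S^(n-1) -> \coprod_j G/H_j x D^n,
   with G = C_2.  Being such a pushout is spelled out as: set-theoretically,
   the open cells biject onto skel n `\` skel (n - 1); topologically, a subset
   of skel n is closed once its traces on skel (n - 1) and on all the closed
   n-cells are. *)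
Record c2cw (X : c2SpaceType) := {
  skel : nat -> set X;
  presk : nat -> set X := fun n => if n is m.+1 then skel m else set0;
  cell : nat -> Type;
  isotropy : forall n, cell n -> bool;
  char_map : forall n (j : cell n), orbit (isotropy j) * disc n -> X;
  presk_sub : forall n, presk n `<=` skel n;
  skel_cover : \bigcup_n skel n = setT;
  skel_colim : forall A : set X,
    (forall n, rel_closed (skel n) A) -> closed A;
  char_continuous : forall n (j : cell n), continuous (@char_map n j);
  char_c2 : forall n (j : cell n) o x,
    @char_map n j (c2 o, x) = c2 (@char_map n j (o, x));
  char_skel : forall n (j : cell n) o x, skel n (@char_map n j (o, x));
  char_sphere : forall n (j : cell n) o x,
    on_sphere x -> presk n (@char_map n j (o, x));
  char_open : forall n (j : cell n) o x,
    ~ on_sphere x -> ~ presk n (@char_map n j (o, x));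
  char_surj : forall n y, skel n y -> ~ presk n y ->
    exists (j : cell n) o x, ~ on_sphere x /\ @char_map n j (o, x) = y;
  char_inj : forall n
    (u v : {j : cell n & (orbit (isotropy j) * disc n)%type}),
    ~ on_sphere (projT2 u).2 -> ~ on_sphere (projT2 v).2 ->
    @char_map n (projT1 u) (projT2 u) = @char_map n (projT1 v) (projT2 v) ->
    u = v;
  skel_pushout : forall n (A : set X), rel_closed (presk n) A ->
    (forall j : cell n, closed (@char_map n j @^-1` A)) ->
    rel_closed (skel n) A
}.

Definition has_c2cw_type (X : c2SpaceType) : Prop :=
  exists2 Y : c2SpaceType, inhabited (c2cw Y) & c2homotopy_equivalent R X Y.

(* [separated] makes K0 `|` K1 a topological disjoint union; as K0 and K1 are
   contractible, hence connected, they are then the components. *)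
Definition is_K2 (K : c2SpaceType) (K0 K1 : set K) : Prop :=
  [/\ has_c2cw_type K,
      contractible R K,
      fixset K = K0 `|` K1,
      separated K0 K1
    & contractible R (set_type K0) /\ contractible R (set_type K1)].

End CW.

(* The topology on T coinduced by a family of maps from spaces. *)
Definition coinduced_topology (I : Type) (S : I -> topologicalType)
  (T : choiceType) (f : forall i, S i -> T) : Type := T.

Section coinduced.
Variables (I : Type) (S : I -> topologicalType) (T : choiceType).
Variable f : forall i, S i -> T.
Arguments f : clear implicits.

Local Notation X := (coinduced_topology f).

HB.instance Definition _ := Choice.on X.

Definition coinduced_open : set_system T :=
  [set U | forall i, open (f i @^-1` U)].

Lemma coinduced_openT : coinduced_open setT.
Proof. by move=> i; rewrite preimage_setT; exact: openT. Qed.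

Lemma coinduced_openI : setI_closed coinduced_open.
Proof. by move=> A B oA oB i; rewrite preimage_setI; exact: openI. Qed.

Lemma coinduced_open_bigU (J : Type) (g : J -> set T) :
  (forall j, coinduced_open (g j)) -> coinduced_open (\bigcup_j g j).
Proof.
by move=> og i; rewrite preimage_bigcup; apply: bigcup_open => j _; exact: og.
Qed.

HB.instance Definition _ := isOpenTopological.Build X
  coinduced_openT coinduced_openI coinduced_open_bigU.

Lemma coinduced_continuous (i : I) :
  continuous (f i : S i -> X).
Proof. by apply/continuousP => A; exact. Qed.

Lemma coinduced_universal (Y : topologicalType) (g : X -> Y) :
  (forall i, continuous (g \o f i)) -> continuous g.
Proof.
move=> gf; apply/continuousP => A oA.
suff: coinduced_open (g @^-1` A) by [].
move=> i; by have /continuousP/(_ A oA) := gf i; rewrite comp_preimage.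
Qed.

End coinduced.

Section projective_space.
Variable R : realType.

Definition Cplx : numClosedFieldType := R[i].

(* C^oo (+) (C^sigma)^oo: a finitely supported sequence of complex numbers is
   encoded as the polynomial having it as coefficients. *)
Definition c2universe : Type := ({poly Cplx} * {poly Cplx})%type.

HB.instance Definition _ := GRing.Lmodule.on c2universe.

(* The colimit topology, from the inclusions of C^n (+) (C^sigma)^n. *)
Definition universe_incl (n : nat) (v : 'rV[Cplx]_n * 'rV[Cplx]_n) :
  c2universe := (rVpoly v.1, rVpoly v.2).

HB.instance Definition _ := Topological.copy c2universe
  (coinduced_topology universe_incl).

Definition universe_c2 (v : c2universe) : c2universe := (v.1, - v.2).

Definition span1 (v : c2universe) : set c2universe :=
  [set c *: v | c in [set: Cplx]].

Definition is_line (L : set c2universe) : Prop :=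
  exists2 v, v != 0 & L = span1 v.

Record BU1 := Line { line_set :> set c2universe; lineP : is_line line_set }.

HB.instance Definition _ := gen_eqMixin BU1.
HB.instance Definition _ := gen_choiceMixin BU1.

Definition nonzero : set c2universe := [set v | v != 0].

Lemma span1_line (v : nonzero) : is_line (span1 (set_val v)).
Proof. by exists (set_val v) => //; exact: (set_valP v). Qed.

Definition line_of (v : nonzero) : BU1 := Line (span1_line v).

(* The quotient topology from the space of nonzero vectors. *)
HB.instance Definition _ := Topological.copy BU1
  (coinduced_topology (fun _ : unit => line_of)).

Lemma BU1_eq (L M : BU1) : L = M :> set c2universe -> L = M.
Proof.
case: L M => [L PL] [M PM] /= LM; case: _ / LM in PM *.
by congr Line; exact: Prop_irrelevance.
Qed.

Lemma universe_c2K : involutive universe_c2.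
Proof. by case=> u v; rewrite /universe_c2 /= opprK. Qed.

Lemma universe_c2_neq0 v : v != 0 -> universe_c2 v != 0.
Proof.
apply: contra => /eqP v0; rewrite -(universe_c2K v) v0 /universe_c2 /= oppr0.
exact/eqP.
Qed.

Lemma universe_c2_continuous : continuous universe_c2.
Proof.
apply: coinduced_universal => n.
have -> : universe_c2 \o @universe_incl n =
    @universe_incl n \o (fun v => (v.1, - v.2)).
  by apply/funext => v; rewrite /universe_c2 /universe_incl /= linearN.
move=> v; apply: continuous_comp; last exact: coinduced_continuous.
apply: (@cvg_pair _ _ _ _ (nbhs v.1) (nbhs (- v.2))); first exact: cvg_fst.
by apply: cvgN; exact: cvg_snd.
Qed.

Lemma image_c2_span1 v : universe_c2 @` span1 v = span1 (universe_c2 v).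
Proof.
have c2Z c : universe_c2 (c *: v) = c *: universe_c2 v.
  by rewrite /universe_c2 /GRing.scale /= /scale_pair /= scalerN.
by apply/seteqP; split=> [_ [_ [c _ <-] <-]|_ [c _ <-]];
  [exists c|exists (c *: v) => //; exists c].
Qed.

Lemma image_c2_line (L : BU1) : is_line (universe_c2 @` L).
Proof.
have [v v0 ->] := lineP L; exists (universe_c2 v).
  exact: universe_c2_neq0.
exact: image_c2_span1.
Qed.

Definition BU1_c2 (L : BU1) : BU1 := Line (image_c2_line L).

Lemma BU1_c2K : involutive BU1_c2.
Proof.
move=> L; apply: BU1_eq => /=; rewrite image_comp.
by rewrite (_ : _ \o _ = id) ?image_id//; apply/funext => v; exact: universe_c2K.
Qed.

Lemma BU1_c2_continuous : continuous BU1_c2.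
Proof.
apply: coinduced_universal => -[].
pose s (v : nonzero) : nonzero :=
  exist _ (universe_c2 (set_val v)) (mem_set (universe_c2_neq0 (set_valP v))).
have -> : BU1_c2 \o line_of = line_of \o s.
  by apply/funext => v; apply: BU1_eq; exact: image_c2_span1.
move=> v; apply: continuous_comp; last first.
  exact: (@coinduced_continuous _ _ _ (fun _ : unit => line_of) tt).
move: v; apply: continuous_comp_initial => v.
apply: (@continuous_comp _ _ _ set_val universe_c2).
  exact: initial_continuous.
exact: universe_c2_continuous.
Qed.

HB.instance Definition _ := isC2Space.Build BU1 BU1_c2_continuous BU1_c2K.

Definition B0 : set BU1 := [set L | forall v, line_set L v -> v.2 = 0].
Definition B1 : set BU1 := [set L | forall v, line_set L v -> v.1 = 0].

Lemma fixset_BU1 : fixset BU1 = B0 `|` B1.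
Proof.
apply/seteqP; split=> L.
  have [v v0 Lv] := lineP L.
  move=> /(congr1 line_set) /= c2L.
  have : line_set L (universe_c2 v).
    by rewrite -c2L; exists v => //; rewrite Lv; exists 1 => //; rewrite scale1r.
  rewrite Lv => -[c _ cv].
  have cv1 : c *: v.1 = v.1 by have := congr1 fst cv.
  have cv2 : c *: v.2 = - v.2 by have := congr1 snd cv.
  have [v1|v1] := eqVneq v.1 0.
    by right=> w; rewrite Lv => -[d _ <-]; rewrite /= v1 scaler0.
  left=> w; rewrite Lv => -[d _ <-] /=.
  suff -> : v.2 = 0 by rewrite scaler0.
  have c1 : c = 1.
    apply/eqP; rewrite -subr_eq0; move: v1; apply: contraR => c1.
    have : (c - 1) *: v.1 == 0 by rewrite scalerBl scale1r cv1 subrr.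
    by rewrite scaler_eq0 (negbTE c1).
  move: cv2; rewrite c1 scale1r => /eqP; rewrite -subr_eq0 opprK -mulr2n.
  by rewrite -scaler_nat scaler_eq0 pnatr_eq0 => /eqP.
have [v v0 Lv] := lineP L.
have Lvv : line_set L v by rewrite Lv; exists 1 => //; rewrite scale1r.
move=> LB; apply: BU1_eq => /=; rewrite Lv image_c2_span1.
case: LB => /(_ v Lvv) vi.
  by congr span1; case: v vi {v0 Lv Lvv} => v1 v2 /= ->;
    rewrite /universe_c2 /= oppr0.
have -> : universe_c2 v = - v.
  by case: v vi {v0 Lv Lvv} => v1 v2 /= ->; congr pair; rewrite oppr0.
by apply/seteqP; split=> _ [c _ <-]; exists (- c) => //;
  rewrite ?scalerN ?scaleNr ?opprK.
Qed.

End projective_space.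

Arguments B0 : clear implicits.
Arguments B1 : clear implicits.

(* Main.v *)
Require Import Defs.
From HB Require Import structures.
From mathcomp Require Import all_boot all_order all_algebra complex.
From mathcomp Require Import all_classical all_reals all_analysis.
From mathcomp Require Import ring lra.
Import numFieldNormedType.Exports.
Local Open Scope classical_set_scope.

(* A section s would give an equivariant line bundle over K whose fibre is the
   trivial representation over K0 and the sign representation over K1. As K
   is contractible, a contraction of K lifts this bundle to a continuous
   family V of nonzero vectors, V k spanning s k, over any compact part of K
   (after truncation to finitely many coordinates). With e the involution of
   the universe, V (c2 k) and e (V k) span the same line, so lam k = 
   <V (c2 k), e (V k)> is a nonvanishing function with lam (c2 k) = conj (lam k),
   positive at the points of K0 and negative at those of K1. Pulling lam
   back along p from half of the sphere of lines in C (+) C^sigma,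
   parametrized by a square, gives a nonvanishing function on the square,
   positive on the side x = 0, negative on the side x = 1, and with
   conjugate values on the two remaining sides. A continuous square root
   kappa of it exists, up to positive factors, on the square; but then
   kappa(x, 0) kappa(x, 1) is real and nonvanishing, positive at x = 0 and
   negative at x = 1. *)

Set Implicit Arguments.
Unset Strict Implicit.
Unset Printing Implicit Defensive.

Import Order.TTheory GRing.Theory Num.Theory.
Local Open Scope ring_scope.

Section obstruction.
Variable R : realType.
Local Notation C := (Cplx R).
Local Notation U := (c2universe R).

(** * Continuity *)

Lemma continuous_comp2 (X Y Z : topologicalType) (f : X -> Y) (g : Y -> Z) :
  continuous f -> continuous g -> continuous (fun x => g (f x)).
Proof. by move=> cf cg x; apply: continuous_comp; [exact: cf|exact: cg]. Qed.

Lemma continuous_pair (X Y Z : topologicalType) (f : X -> Y) (g : X -> Z) :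
  continuous f -> continuous g -> continuous (fun x => (f x, g x)).
Proof. by move=> cf cg x; apply: cvg_pair; [exact: cf|exact: cg]. Qed.

Lemma continuous_fst (X Y : topologicalType) : continuous (@fst X Y).
Proof. by move=> x; exact: cvg_fst. Qed.

Lemma continuous_snd (X Y : topologicalType) : continuous (@snd X Y).
Proof. by move=> x; exact: cvg_snd. Qed.

Lemma continuous_mul (X : topologicalType) (K : numFieldType) (f g : X -> K) :
  continuous f -> continuous g -> continuous (fun x => f x * g x).
Proof. by move=> cf cg x; apply: cvgM; [exact: cf|exact: cg]. Qed.

Lemma within_continuous_comp (X Y Z : topologicalType) (S : set Y)
    (g : Y -> Z) (f : X -> Y) : {within S, continuous g} -> continuous f ->
  (forall x, S (f x)) -> continuous (fun x => g (f x)).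
Proof.
move=> /subspace_continuousP cg cf Sf x P /(cg _ (Sf x)) gP.
have := cf x _ gP; rewrite /nbhs /=.
by apply: filterS => y; apply.
Qed.

Lemma continuous_Re : continuous (fun z : C => complex.Re z).
Proof.
move=> z; apply/(@cvgrPdist_lt _ _ _ (nbhs z) _) => e e0.
have e0' : 0 < (e%:C)%C :> C by rewrite ltcR.
have /(@cvgrPdist_lt _ C _ (nbhs z) _)/(_ _ e0') := @cvg_id _ (nbhs z).
apply: filterS => w zw; rewrite -ltcR; apply: le_lt_trans zw.
have -> : complex.Re z - complex.Re w = complex.Re (z - w).
  by case: z w => ? ? [].
exact: normc_ge_Re.
Qed.

Lemma continuous_conj : continuous (fun z : C => z^*).
Proof.
move=> z; apply/(@cvgrPdist_lt _ C _ (nbhs z) _) => e e0.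
have /(@cvgrPdist_lt _ C _ (nbhs z) _)/(_ _ e0) := @cvg_id _ (nbhs z).
by apply: filterS => w; rewrite -rmorphB norm_conjC.
Qed.

Lemma continuous_real_complex : continuous (fun x : R => (x%:C)%C : C).
Proof.
move=> x; apply/(@cvgrPdist_lt _ C _ (nbhs x) _) => e e0.
(* Being positive, [e] is real, so its real part serves as a tolerance in [R]. *)
have eR : ((complex.Re e)%:C)%C = e by apply/RRe_real/gtr0_real.
have e0' : 0 < complex.Re e by rewrite -ltcR eR.
have /(@cvgrPdist_lt _ R _ (nbhs x) _)/(_ _ e0') := @cvg_id _ (nbhs x).
apply: filterS => y xy.
by rewrite -rmorphB normc_def /= expr0n addr0 sqrtr_sqr -eR ltcR.
Qed.

(** A Lebesgue number argument over the compact [A] times [0, 1]. It supplies the mesh of the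
    subdivisions, both for the square root and for the lifting of lines. *)
Lemma compact_near_diagonal (T : topologicalType) (A : set T)
    (P : set (T * (R * R))) : compact A -> open P ->
    (forall x t, A x -> 0 <= t <= 1 -> P (x, (t, t))) ->
  exists N : nat, forall x t t', A x -> 0 <= t <= 1 ->
    `|t' - t| <= N.+1%:R^-1 -> P (x, (t, t')).
Proof.
move=> cA oP diagP.
have cI : compact `[0 : R, 1] by exact: segment_compact.
have /compact_near_coveringP := compact_setX cA cI.
move=> /(_ nat \oo (fun n z => forall t', `|t' - z.2| <= n.+1%:R^-1 ->
  P (z.1, (z.2, t'))) _) [].
  move=> [x t] [/= Ax /=]; rewrite in_itv /= => t01.
  have : nbhs (x, (t, t)) P.
    exact: open_nbhs_nbhs (conj oP (diagP _ _ Ax t01)).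
  case=> -[/= U V] [Ux [[V1 V2] /= [V1t V2t] V12]] UV.
  have [/= e e0 eV2] := (nbhs_ballP _ _).1 V2t.
  (* Half of [e] absorbs the distance from [t] to [s], the other half that from [s] to [t']. *)
  have e20 : 0 < e / 2 by rewrite divr_gt0.
  exists (U `*` (V1 `&` ball t (e / 2)), [set n | n.+1%:R^-1 < e / 2]) => [|z].
    split; last exact: near_infty_natSinv_lt (PosNum e20).
    exists (U, V1 `&` ball t (e / 2)) => //; split => //=.
    by apply: filterI => //; exact: nbhsx_ballx.
  case: z => [[x' s] n] [/= [Ux' [V1s ts]]] ne t' st'; apply: UV; split => //=.
  apply: V12; split => //=; apply: eV2; rewrite /ball /=.
  have -> : t - t' = (t - s) + (s - t') by rewrite addrA subrK.
  apply: le_lt_trans (ler_normD _ _) _; rewrite [e in _ < e]splitr.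
  apply: ltr_leD; first exact: ts.
  by rewrite distrC; apply: le_trans st' (ltW ne).
move=> N _ /(_ N (leqnn N)) NP; exists N => x t t' Ax t01.
by apply: (NP (x, t)); split => //=; rewrite in_itv. Qed.

Lemma continuous_sum (X : topologicalType) (I : finType) (f : I -> X -> C) :
  (forall i, continuous (f i)) -> continuous (fun x => \sum_i f i x).
Proof. by move=> cf; apply: continuous_big => //; exact: add_continuous. Qed.

Lemma open_neq0 : open [set z : C | z != 0].
Proof.
have -> : [set z : C | z != 0] = ~` [set 0].
  by apply/seteqP; split => z /eqP.
apply/closed_openC/accessible_closed_set1/hausdorff_accessible.
exact: (@norm_hausdorff C C).
Qed.

Lemma continuous_const_mx (m n : nat) :
  continuous (fun c : C => const_mx c : 'M[C]_(m, n)).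
Proof.
move=> c P [Q Qc QP].
have Qnear : \forall a \near c, forall ij : 'I_m * 'I_n, Q ij.1 ij.2 a.
  apply: (@filter_forall _ _ (fun ij : 'I_m * 'I_n => Q ij.1 ij.2) _
    (nbhs_filter c)) => -[i j].
  by have := Qc i j; rewrite mxE.
apply: filterS Qnear => a Qa; apply: QP => i j.
by rewrite mxE; exact: (Qa (i, j)).
Qed.

(** * Nonvanishing functions on the square *)

Lemma continuous_add_norm : continuous (fun z : C => z + `|z|).
Proof.
by move=> z; exact: (cvgD (@cvg_id _ (nbhs z)) (@norm_continuous _ C z)).
Qed.

Lemma sqr_gt0_Im0 (z : C) : 0 < z ^+ 2 -> complex.Im z = 0 /\ complex.Re z != 0.
Proof.
case: z => a b; rewrite expr2 ltcE /= => /andP[/eqP ab0].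
have [->|a0] := eqVneq a 0.
  by rewrite mul0r sub0r oppr_gt0 => /lt_geF; rewrite -expr2 sqr_ge0.
move=> _; split=> //; apply/eqP; move/eqP: ab0.
by rewrite [b * a]mulrC -mulr2n mulrn_eq0 mulf_eq0 (negbTE a0).
Qed.

Lemma sqr_lt0_Re0 (z : C) : z ^+ 2 < 0 -> complex.Re z = 0 /\ complex.Im z != 0.
Proof.
move=> z0; have : 0 < (z * 'i) ^+ 2 by rewrite exprMn sqrCi mulrN1 oppr_gt0.
by move=> /sqr_gt0_Im0; rewrite -complexiE ReiNIm ImiRe oppr_eq0.
Qed.

Lemma continuous_same_sign (f : R -> R) : continuous f ->
  (forall t, 0 <= t <= 1 -> f t != 0) -> 0 < f 0 * f 1.
Proof.
move=> cf f0.
wlog f0_gt0 : f cf f0 / 0 < f 0.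
  move=> W; have := f0 0; rewrite lexx ler01 => /(_ isT).
  rewrite neq_lt => /orP[f00|]; last exact: W.
  rewrite -mulrNN; apply: (W (fun t => - f t)) => [t|t t01|].
  - exact: cvgN (cf t).
  - by rewrite oppr_eq0; exact: f0.
  - by rewrite oppr_gt0.
rewrite pmulr_rgt0// ltNge; apply/negP => f1.
have [|||t t01 ft] := @IVT R f 0 1 0.
- exact: ler01.
- exact: continuous_subspaceT.
- by rewrite ge_min f1 orbT le_max (ltW f0_gt0).
by have := f0 t; rewrite ft eqxx; move: t01; rewrite in_itv /= => -> /(_ isT).
Qed.

(* Up to a positive factor, a square root of z on the half-plane Re z > 0. *)
Definition add_norm (z : C) : C := z + `|z|.

Lemma add_norm_sqr (z : C) : 0 < complex.Re z ->
  exists2 r : C, 0 < r & add_norm z ^+ 2 = r * z.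
Proof.
(* Expand, with the square of [|z|] written as [z * z^*], and factor out [z]. *)
move=> z0; exists (z + z^* + 2 * `|z|); last first.
  rewrite /add_norm sqrrD normCK; ring.
have -> : z + z^* = 2 * (complex.Re z)%:C%C by exact: addcJ.
by rewrite ltr_pwDl ?mulr_ge0// mulr_gt0// ltcR.
Qed.

(** The square root is a product of square roots of successive ratios of [lam] along a fine
    subdivision of the segment from (0, y) to (x, y). *)
Lemma no_sign_change (lam : R * R -> C) : continuous lam ->
  (forall x y, 0 <= x <= 1 -> 0 <= y <= 1 -> lam (x, y) != 0) ->
  (forall y, 0 <= y <= 1 -> 0 < lam (0, y)) ->
  (forall y, 0 <= y <= 1 -> lam (1, y) < 0) ->
  (forall x, 0 <= x <= 1 -> lam (x, 1) = (lam (x, 0))^*) -> False.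
Proof.
move=> clam lam0 lamx0 lamx1 lamJ.
(* Up to a positive factor, the ratio of two values of [lam] at the same height; its real part is
   positive when the two abscissas are close. *)
pose D (z : R * (R * R)) : C := lam (z.2.2, z.1) * (lam (z.2.1, z.1))^*.
have cD : continuous D.
  apply: continuous_mul.
    apply: continuous_comp2 clam.
    apply: continuous_pair; last exact: continuous_fst.
    exact: continuous_comp2 (@continuous_snd _ _) (@continuous_snd _ _).
  apply: continuous_comp2 continuous_conj.
  apply: continuous_comp2 clam.
  apply: continuous_pair; last exact: continuous_fst.
  exact: continuous_comp2 (@continuous_snd _ _) (@continuous_fst _ _).
have oD : open (D @^-1` [set z | 0 < complex.Re z]).
  move/continuousP : cD; apply.
  by move/continuousP : continuous_Re => /(_ _ (@open_gt R 0)).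
have mulJ_gt0 (z : C) : z != 0 -> 0 < z * z^*.
  by move=> z0; rewrite -normCK exprn_gt0 ?normr_gt0.
have [|N DN] := @compact_near_diagonal R _ _ (@segment_compact R 0 1) oD.
  move=> y t; rewrite /= in_itv /= => y01 t01; rewrite /D /=.
  by have := mulJ_gt0 _ (lam0 _ _ t01 y01); rewrite ltcE => /andP[].
pose q j : R := j%:R / N.+1%:R.
have q01 j : (j <= N.+1)%N -> 0 <= q j <= 1.
  by move=> jN; rewrite divr_ge0//= ler_pdivrMr ?ltr0n// mul1r ler_nat.
(* Scaling the subdivision by [z.1] makes it end at [z] for [m = N.+1], while keeping the product
   continuous in both coordinates. *)
pose kappa m (z : R * R) : C :=
  \prod_(j < m) add_norm (D (z.2, (q j * z.1, q j.+1 * z.1))).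
have ckappa m : continuous (kappa m).
  apply: continuous_big; first exact: mul_continuous.
  move=> j _; apply: continuous_comp2 continuous_add_norm.
  apply: continuous_comp2 cD; apply: continuous_pair.
    exact: continuous_snd.
  by apply: continuous_pair; apply: continuous_mul;
    [exact: cst_continuous|exact: continuous_fst|
     exact: cst_continuous|exact: continuous_fst].
have kappa0 m y : 0 <= y <= 1 -> 0 < kappa m (0, y).
  move=> y01; rewrite prodr_gt0// => j _; rewrite /D /= !mulr0.
  have D0 : 0 < lam (0, y) * (lam (0, y))^*.
    by apply/mulJ_gt0/lam0 => //; rewrite lexx ler01.
  by rewrite addr_gt0// normr_gt0 gt_eqF.
have kappa_sqr x y m : 0 <= x <= 1 -> 0 <= y <= 1 -> (m <= N.+1)%N ->
    exists2 r : C, 0 < r & kappa m (x, y) ^+ 2 = r * lam (q m * x, y).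
  move=> x01 y01; elim: m => [_|m IH mN].
    (* The empty product squares to 1, and [lam] is already positive on the side x = 0. *)
    exists (lam (0, y))^-1; first by rewrite invr_gt0 lamx0.
    rewrite /kappa big_ord0 expr1n /q !mul0r mulVf// gt_eqF//; exact: lamx0.
  have [r r0 IHr] := IH (ltnW mN).
  have qx01 j : (j <= N.+1)%N -> 0 <= q j * x <= 1.
    move=> /q01 /andP[qj0 qj1]; case/andP: x01 => x0 x1.
    by rewrite mulr_ge0//= mulr_ile1.
  have : 0 < complex.Re (D (y, (q m * x, q m.+1 * x))).
    apply: DN => //; first exact/qx01/ltnW.
    rewrite -mulrBl /q -mulrBl -natrB ?leqnSn// subSnn mul1r normrM.
    rewrite ger0_norm ?invr_ge0 ?ler0n//; case/andP: x01 => x0 x1.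
    by rewrite ger0_norm// ler_piMr// invr_ge0 ler0n.
  move=> /add_norm_sqr[r' r'0 r'E].
  exists (r * r' * (lam (q m * x, y) * (lam (q m * x, y))^*)).
    apply: mulr_gt0; first exact: mulr_gt0.
    by apply/mulJ_gt0/lam0 => //; exact/qx01/ltnW.
  rewrite /kappa big_ord_recr exprMn -/(kappa m (x, y)) IHr /= r'E /D /=; ring.
have qN : q N.+1 = 1 by rewrite /q divff// pnatr_eq0.
have {qN} kappa_sqr x y : 0 <= x <= 1 -> 0 <= y <= 1 ->
    exists2 r : C, 0 < r & kappa N.+1 (x, y) ^+ 2 = r * lam (x, y).
  move=> x01 y01; have := kappa_sqr x y N.+1 x01 y01 (leqnn _).
  by rewrite qN mul1r.
have I0 : 0 <= (0 : R) <= 1 by rewrite lexx ler01.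
have I1 : 0 <= (1 : R) <= 1 by rewrite lexx ler01.
move: (kappa _) (ckappa N.+1) (kappa0 N.+1) kappa_sqr => k ck k0 ksqr.
have k1 y : 0 <= y <= 1 ->
    complex.Re (k (1, y)) = 0 /\ complex.Im (k (1, y)) != 0.
  move=> y01; have [r r0 kr] := ksqr 1 y I1 y01.
  by apply: sqr_lt0_Re0; rewrite kr pmulr_rlt0// lamx1.
pose mu x : C := k (x, 0) * k (x, 1).
(* By [lamJ], the square of [mu x] is a positive multiple of [lam (x, 0)] times its conjugate, so
   [mu x] is real and nonzero. *)
have mu0 x : 0 <= x <= 1 -> complex.Re (mu x) != 0.
  move=> x01; have [r r0 kr] := ksqr x 0 x01 I0.
  have [r' r'0 kr'] := ksqr x 1 x01 I1.
  apply: (proj2 (@sqr_gt0_Im0 (mu x) _)).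
  rewrite /mu exprMn kr kr' mulrACA lamJ//.
  by apply: mulr_gt0; [exact: mulr_gt0|exact/mulJ_gt0/lam0].
have := @continuous_same_sign (fun x => complex.Re (mu x)) _ mu0.
have -> : complex.Re (mu 0) = complex.Re (k (0, 0)) * complex.Re (k (0, 1)).
  have /gtr0_real := k0 _ I0; have /gtr0_real := k0 _ I1; rewrite /mu.
  case: (k (0, 0)) (k (0, 1)) => [a b] [c d].
  rewrite !complex_real => /eqP-> /eqP->.
  by rewrite /= mul0r subr0.
(* Both factors are purely imaginary, since [lam] is negative on the side x = 1. *)
have -> : complex.Re (mu 1) = - (complex.Im (k (1, 0)) * complex.Im (k (1, 1))).
  have [+ _] := k1 _ I0; have [+ _] := k1 _ I1; rewrite /mu.
  by case: (k (1, 0)) (k (1, 1)) => [a b] [c d] /= -> ->; rewrite mul0r sub0r.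
have Rek0 y : 0 <= y <= 1 -> 0 < complex.Re (k (0, y)).
  by move=> /k0; rewrite ltcE => /andP[].
rewrite pmulr_rgt0 ?mulr_gt0 ?Rek0// oppr_gt0 => Im_lt0.
have ck1 : continuous (fun y => complex.Im (k (1, y))).
  have -> : (fun y => complex.Im (k (1, y))) =
      (fun y => complex.Re (- ('i%C) * k (1, y))).
    by apply/funext => y; rewrite mulNr mulrC raddfN /= ReiNIm opprK.
  apply: continuous_comp2 continuous_Re; apply: continuous_mul.
    exact: cst_continuous.
  apply: continuous_comp2 ck.
  apply: continuous_pair; first exact: cst_continuous.
  exact: idfun_continuous.
(* The imaginary part cannot change sign along x = 1, so the real part of [mu] would be positive at
   0 and negative at 1. *)
have : 0 < complex.Im (k (1, 0)) * complex.Im (k (1, 1)).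
  by apply: (@continuous_same_sign _ ck1) => y y01; exact: (proj2 (k1 _ y01)).
rewrite ltNge ltW//; apply: Im_lt0.
apply: continuous_comp2 continuous_Re; apply: continuous_mul;
  apply: continuous_comp2 ck; apply: continuous_pair;
  by [exact: idfun_continuous|exact: cst_continuous].
Qed.

(** * Lines *)

(** [true] selects the trivial summand and [false] the sign summand, so that the involution
    multiplies by [(-1) ^+ (~~ b)]. *)
Definition coord (v : U) (b : bool) (i : nat) : C :=
  (if b then v.1 else v.2)`_i.

Lemma coordZ (c : C) (v : U) b i : coord (c *: v) b i = c * coord v b i.
Proof. by case: b; rewrite /coord coefZ. Qed.

Lemma coord_c2 (v : U) b i :
  coord (universe_c2 v) b i = (-1) ^+ (~~ b) * coord v b i.
Proof. by case: b; rewrite /coord /= ?expr0 ?expr1 ?mul1r ?mulN1r ?coefN. Qed.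

Lemma coord_neq0 (v : U) : v != 0 -> exists b i, coord v b i != 0.
Proof.
apply: contraPP => /forallNP v0.
have {}v0 b i : coord v b i = 0.
  by have /forallNP/(_ i)/negP := v0 b; rewrite negbK => /eqP.
apply/negP; rewrite negbK; case: v v0 => p q v0.
by apply/eqP; congr pair; apply/polyP => i; rewrite coef0;
  [exact: (v0 true i)|exact: (v0 false i)].
Qed.

Lemma continuous_rVpoly_coef n i :
  continuous (fun w : 'rV[C]_n => (rVpoly w)`_i).
Proof.
have [ni|ni] := leqP n i.
  have -> : (fun w : 'rV[C]_n => (rVpoly w)`_i) = cst 0.
    by apply/funext => w; rewrite nth_default// (leq_trans (size_poly _ _)).
  exact: cst_continuous.
have -> : (fun w : 'rV[C]_n => (rVpoly w)`_i) = (fun w => w ord0 (Ordinal ni)).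
  by apply/funext => w; rewrite (coef_rVpoly_ord w (Ordinal ni)).
exact: coord_continuous.
Qed.

Lemma continuous_coord b i : continuous (fun v : U => coord v b i).
Proof.
apply: coinduced_universal => n; case: b.
  exact: continuous_comp2 (@continuous_fst _ _) (@continuous_rVpoly_coef n i).
exact: continuous_comp2 (@continuous_snd _ _) (@continuous_rVpoly_coef n i).
Qed.

(** A truncated Hermitian product, conjugate-linear in [w']. It takes bare coordinate families
    because the lifts are only controlled coordinatewise. *)
Definition dot n (w w' : bool -> nat -> C) : C :=
  \sum_(p : bool * 'I_n) w p.1 p.2 * (w' p.1 p.2)^*.

(* The bound covers all coefficients; any larger one gives the same value. *)
Definition sqnorm (v : U) : C :=
  dot (maxn (size v.1) (size v.2)) (coord v) (coord v).

Lemma sqnormE n (v : U) : (size v.1 <= n)%N -> (size v.2 <= n)%N ->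
  sqnorm v = dot n (coord v) (coord v).
Proof.
move=> s1 s2; rewrite /sqnorm /dot.
have E m : \sum_(p : bool * 'I_m) coord v p.1 p.2 * (coord v p.1 p.2)^* =
    \sum_b \sum_(i < m) coord v b i * (coord v b i)^*.
  by rewrite pair_bigA.
rewrite !E; apply: eq_bigr => b _.
have mn : (maxn (size v.1) (size v.2) <= n)%N by rewrite geq_max s1.
rewrite (big_ord_widen n (fun i => coord v b i * (coord v b i)^*)) //.
rewrite [RHS](bigID (fun i : 'I_n => (i < maxn (size v.1) (size v.2))%N)) /=.
rewrite [X in _ = _ + X]big1 ?addr0// => i.
rewrite -leqNgt geq_max => /andP[i1 i2].
by rewrite /coord; case: b; rewrite nth_default// mul0r.
Qed.

Lemma dot_gt0 n w b i : (i < n)%N -> w b i != 0 -> 0 < dot n w w.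
Proof.
move=> ni wi; rewrite /dot (bigD1 (b, Ordinal ni))//=.
rewrite ltr_pwDl//; first by rewrite -normCK exprn_gt0// normr_gt0.
by apply: sumr_ge0 => p _; rewrite -normCK exprn_ge0.
Qed.

Lemma sqnorm_gt0 (v : U) : v != 0 -> 0 < sqnorm v.
Proof.
move=> /coord_neq0[b [i vi]].
rewrite (@sqnormE (maxn i.+1 (maxn (size v.1) (size v.2)))).
- by apply: (dot_gt0 _ vi); rewrite leq_max leqnn.
- by rewrite leq_max leq_max leqnn orbT.
- by rewrite leq_max leq_max leqnn !orbT.
Qed.

Lemma dotZ n (c d : C) w w' :
  dot n (fun b i => c * w b i) (fun b i => d * w' b i) = c * d^* * dot n w w'.
Proof.
by rewrite /dot mulr_sumr; apply: eq_bigr => p _; rewrite rmorphM; ring.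
Qed.

Lemma dotZl n (c : C) w w' : dot n (fun b i => c * w b i) w' = c * dot n w w'.
Proof. by rewrite /dot mulr_sumr; apply: eq_bigr => p _; rewrite mulrA. Qed.

Lemma sqnormZ (c : C) (v : U) : sqnorm (c *: v) = c * c^* * sqnorm v.
Proof.
pose n := maxn (size v.1) (size v.2).
rewrite (@sqnormE n (c *: v)); last 2 first.
- by rewrite (leq_trans (size_scale_leq _ _))// leq_maxl.
- by rewrite (leq_trans (size_scale_leq _ _))// leq_maxr.
rewrite -dotZ; congr dot; apply/funext => b; apply/funext => i; exact: coordZ.
Qed.

Lemma continuous_dot (X : topologicalType) n (w w' : X -> bool -> nat -> C) :
  (forall b i, continuous (fun x => w x b i)) ->
  (forall b i, continuous (fun x => w' x b i)) ->
  continuous (fun x => dot n (w x) (w' x)).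
Proof.
move=> cw cw'; apply: continuous_big; first exact: add_continuous.
move=> p _; apply: continuous_mul; first exact: cw.
by apply: continuous_comp2 (cw' _ _) continuous_conj.
Qed.

Lemma continuous_sqnorm : continuous sqnorm.
Proof.
apply: coinduced_universal => n.
(* On stage [n] of the colimit all sizes are at most [n], so the varying bound can be fixed. *)
have -> : sqnorm \o @universe_incl R n =
    (fun w => dot n (coord (universe_incl w)) (coord (universe_incl w))).
  by apply/funext => w; apply: sqnormE; exact: size_poly.
have ci : continuous (@universe_incl R n : _ -> U)
  by exact: (@coinduced_continuous _ _ _ (@universe_incl R) n).
by apply: continuous_dot => b i;
  exact: continuous_comp2 ci (@continuous_coord b i).
Qed.

(** An arbitrary choice, with no continuity in [L]; continuity is obtained only for expressions
    invariant under rescaling. *)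
Definition rep (L : BU1 R) : U := sval (cid2 (lineP L)).

Lemma rep_neq0 L : rep L != 0.
Proof. by rewrite /rep; case: cid2. Qed.

Lemma rep_span L : line_set L = span1 (rep L).
Proof. by rewrite /rep; case: cid2. Qed.

Lemma rep_in (L : BU1 R) : line_set L (rep L).
Proof. by rewrite rep_span; exists 1 => //; rewrite scale1r. Qed.

Lemma rep_scale (L : BU1 R) v : line_set L v -> v != 0 ->
  exists2 c : C, c != 0 & rep L = c *: v.
Proof.
rewrite rep_span => -[c _ cv] v0.
have c0 : c != 0 by apply: contraNneq v0 => c0; rewrite -cv c0 scale0r.
by exists c^-1; rewrite ?invr_eq0// -cv scalerA mulVf// scale1r.
Qed.

Lemma rep_c2 (L : BU1 R) : exists2 d : C, d != 0 &
  forall b i, coord (rep (c2 L)) b i = d * ((-1) ^+ (~~ b) * coord (rep L) b i).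
Proof.
have [||d d0 dE] := @rep_scale (c2 L) (universe_c2 (rep L)).
- by exists (rep L) => //; rewrite rep_span; exists 1 => //; rewrite scale1r.
- exact/universe_c2_neq0/rep_neq0.
by exists d => // b i; rewrite dE coordZ coord_c2.
Qed.

(** The matrix entries of the orthogonal projection onto [L], which do not depend on the spanning
    vector. *)
Definition proj (L : BU1 R) b i b' i' : C :=
  coord (rep L) b i * (coord (rep L) b' i')^* / sqnorm (rep L).

Lemma proj_line_of v b i b' i' : proj (line_of v) b i b' i' =
  coord (set_val v) b i * (coord (set_val v) b' i')^* / sqnorm (set_val v).
Proof.
have v0 : set_val v != 0 := set_valP v.
have [|c c0 E] := @rep_scale (line_of v) (set_val v) _ v0.
  by exists 1 => //; rewrite scale1r.
rewrite /proj E !coordZ sqnormZ rmorphM.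
have N0 : sqnorm (set_val v) != 0 by rewrite gt_eqF// sqnorm_gt0.
have cJ0 : c^* != 0 by rewrite conjC_eq0.
by rewrite mulrACA -mulf_div divff ?mul1r ?mulf_neq0.
Qed.

Lemma continuous_proj b i b' i' : continuous (fun L => proj L b i b' i').
Proof.
apply: coinduced_universal => -[].
have cval : continuous (set_val : @nonzero R -> U) by exact: initial_continuous.
have -> : (fun L => proj L b i b' i') \o @line_of R = (fun v =>
    coord (set_val v) b i * (coord (set_val v) b' i')^* *
    (sqnorm (set_val v))^-1).
  by apply/funext => v; exact: proj_line_of.
apply: continuous_mul; first apply: continuous_mul.
- exact: continuous_comp2 cval (@continuous_coord b i).
- apply: continuous_comp2 continuous_conj.
  exact: continuous_comp2 cval (@continuous_coord b' i').
- have cN := continuous_comp2 cval continuous_sqnorm => v.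
  by apply: (cvgV _ (cN v)); rewrite gt_eqF// sqnorm_gt0//; exact: (set_valP v).
Qed.

(** * Lifting lines to vectors *)

Definition project n (L : BU1 R) (w : bool -> nat -> C) b i : C :=
  \sum_(p : bool * 'I_n) proj L b i p.1 p.2 * w p.1 p.2.

Lemma projectE n L w b i : project n L w b i =
  dot n w (coord (rep L)) / sqnorm (rep L) * coord (rep L) b i.
Proof.
rewrite /project /dot !mulr_suml; apply: eq_bigr => p _.
by rewrite /proj; ring.
Qed.

(** The trace of the product of the two truncated projections, hence continuous in the lines. It
    vanishes exactly when the truncated spanning vectors are orthogonal. *)
Definition overlap n (L L' : BU1 R) : C :=
  \sum_(p : bool * 'I_n) \sum_(q : bool * 'I_n)
    proj L p.1 p.2 q.1 q.2 * proj L' q.1 q.2 p.1 p.2.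

Lemma overlapE n L L' : overlap n L L' =
  dot n (coord (rep L)) (coord (rep L')) / sqnorm (rep L) *
  (dot n (coord (rep L')) (coord (rep L)) / sqnorm (rep L')).
Proof.
rewrite /overlap /dot 2!mulr_suml; apply: eq_bigr => p _.
rewrite mulr_suml mulr_sumr; apply: eq_bigr => q _.
by rewrite /proj; ring.
Qed.

(* The lift is transported along x |-> G (x, t) by projecting orthogonally from
   each line to the next, in steps so small that consecutive lines, truncated to
   their first n coordinates, are never orthogonal. *)
Lemma line_lifting (X : topologicalType) (A : set X) (G : X * R -> BU1 R)
    (L0 : BU1 R) : compact A -> continuous G -> (forall x, G (x, 0) = L0) ->
  exists n (V : X -> bool -> nat -> C),
    (forall b i, continuous (fun x => V x b i)) /\
    forall x, A x ->
      0 < dot n (coord (rep (G (x, 1)))) (coord (rep (G (x, 1)))) /\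
      exists2 c : C, c != 0 &
        forall b i, V x b i = c * coord (rep (G (x, 1))) b i.
Proof.
move=> cA cG G0.
(* Each line has a nonzero coordinate, which stays nonzero on nearby lines; compactness then gives
   one truncation for all of them. *)
have [n nP] : exists n, forall x t, A x -> 0 <= t <= 1 ->
    0 < dot n (coord (rep (G (x, t)))) (coord (rep (G (x, t)))).
  have /compact_near_coveringP := compact_setX cA (@segment_compact R 0 1).
  move=> /(_ nat \oo (fun n z =>
    0 < dot n (coord (rep (G z))) (coord (rep (G z)))) _) [].
    move=> z _; have [b [i bi]] := coord_neq0 (rep_neq0 (G z)).
    have cp : continuous (fun z => proj (G z) b i b i).
      exact: continuous_comp2 cG (@continuous_proj b i b i).
    have /continuousP/(_ _ open_neq0) oz := cp.
    exists ((fun z => proj (G z) b i b i) @^-1` [set z : C | z != 0],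
            [set n | (i < n)%N]) => [|[z' n] /= [+ ni]].
      split; last by exists i.+1.
      apply: open_nbhs_nbhs; split => //=.
      rewrite /proj !mulf_eq0 conjC_eq0 invr_eq0 (negbTE bi) /= gt_eqF//.
      exact/sqnorm_gt0/rep_neq0.
    by rewrite /proj !mulf_eq0 !negb_or => /andP[/andP[+ _] _]; exact: dot_gt0.
  move=> n _ /(_ n (leqnn n)) nP; exists n => x t Ax t01.
  by apply: nP; split => //=; rewrite in_itv.
pose P :=
  [set z : X * (R * R) | overlap n (G (z.1, z.2.1)) (G (z.1, z.2.2)) != 0].
have oP : open P.
  have cL f : continuous f -> forall b i b' i',
      continuous (fun z : X * (R * R) => proj (G (z.1, f z.2)) b i b' i').
    move=> cf b i b' i'.
    apply: continuous_comp2 (@continuous_proj b i b' i').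
    apply: continuous_comp2 cG.
    apply: continuous_pair; first exact: continuous_fst.
    exact: continuous_comp2 (@continuous_snd _ _) cf.
  have cO : continuous (fun z : X * (R * R) =>
      overlap n (G (z.1, z.2.1)) (G (z.1, z.2.2))).
    apply: continuous_sum => p; apply: continuous_sum => q.
    by apply: continuous_mul; [exact: (cL fst (@continuous_fst _ _))|
                               exact: (cL snd (@continuous_snd _ _))].
  by have /continuousP/(_ _ open_neq0) := cO.
have [|N NP] := compact_near_diagonal cA oP.
  move=> x t Ax t01; rewrite /P /= overlapE.
  by rewrite gt_eqF// !mulr_gt0 ?invr_gt0 ?sqnorm_gt0 ?rep_neq0// nP.
pose q j : R := j%:R / N.+1%:R.
(* The start is constant because all paths begin at [L0]. In the successor case [m] is still the
   successor, so [W m x] lies on [G (x, q m)]. *)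
pose W := fix W m x := if m is m'.+1 then project n (G (x, q m)) (W m' x)
                       else coord (rep L0).
have cW m b i : continuous (fun x => W m x b i).
  elim: m b i => [|m IH] b i /=; first exact: cst_continuous.
  apply: continuous_sum => p; apply: continuous_mul; last exact: IH.
  apply: continuous_comp2 (@continuous_proj _ _ _ _).
  apply: continuous_comp2 cG.
  apply: continuous_pair; first exact: idfun_continuous.
  exact: cst_continuous.
exists n, (W N.+1); split => // x Ax; split.
  by apply: nP => //; rewrite lexx ler01.
suff /(_ N.+1 (leqnn _)) : forall m, (m <= N.+1)%N -> exists2 c : C, c != 0 &
    forall b i, W m x b i = c * coord (rep (G (x, q m))) b i.
  by rewrite /= (_ : q N.+1 = 1)// /q divff// pnatr_eq0.
elim=> [_|m IH mN].
  by exists 1; rewrite ?oner_eq0// => b i; rewrite /q mul0r G0 mul1r.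
have [c c0 Wm] := IH (ltnW mN).
exists (dot n (W m x) (coord (rep (G (x, q m.+1)))) /
        sqnorm (rep (G (x, q m.+1)))).
  2: by move=> b i; rewrite /= projectE.
have : P (x, (q m, q m.+1)).
  apply: NP => //.
    by rewrite divr_ge0//= ler_pdivrMr ?ltr0n// mul1r ler_nat ltnW.
  by rewrite /q -mulrBl -natrB ?leqnSn// subSnn mul1r ger0_norm// invr_ge0.
rewrite /P /= overlapE !mulf_eq0 !negb_or => /andP[/andP[d0 _] /andP[_ N0]].
have -> : W m x = fun b i => c * coord (rep (G (x, q m))) b i.
  by apply/funext => b; apply/funext => i; exact: Wm.
by rewrite dotZl !mulf_neq0.
Qed.

(** * Homotopies with time extended to [R], and the transition function *)

(* Closed form of the retraction of R onto [0, 1]. *)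
Definition clip (t : R) : R := (1 + `|t| - `|1 - t|) / 2.

Lemma clip_continuous : continuous clip.
Proof.
move=> t; apply: cvgM; last exact: cvg_cst.
apply: cvgB; first apply: cvgD; first exact: cvg_cst.
  exact: (@norm_continuous _ R t).
have cB : continuous (fun t : R => 1 - t).
  by move=> u; apply: cvgB; [exact: cvg_cst|exact: cvg_id].
exact: (continuous_comp2 cB (@norm_continuous _ R)).
Qed.

Lemma clip_itv t : 0 <= clip t <= 1.
Proof. by rewrite /clip; case: (ger0P t); case: (ger0P (1 - t)); lra. Qed.

Lemma clip0 : clip 0 = 0. Proof. by rewrite /clip normr0 subr0 normr1; lra. Qed.
Lemma clip1 : clip 1 = 1. Proof. by rewrite /clip subrr normr0 normr1; lra. Qed.

Lemma homotopy_clip_continuous (X Y : topologicalType) (f g : X -> Y) H :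
  is_homotopy f g H -> continuous (fun z : X * R => H (z.1, clip z.2)).
Proof.
move=> [cH _ _].
apply: (within_continuous_comp cH) => [|z]; last exact: clip_itv.
apply: continuous_pair; first exact: continuous_fst.
exact: continuous_comp2 (@continuous_snd _ _) clip_continuous.
Qed.

(** The track of a fixed point under an equivariant homotopy is connected and stays in the fixed
    set, so it cannot pass between separated pieces. *)
Lemma c2homotopic_fixed_component (K : c2SpaceType) (K0 K1 : set K)
    (f g : K -> K) :
  Defs.fixset K = K0 `|` K1 -> separated K0 K1 -> c2homotopic R f g ->
  forall k, c2 k = k -> K0 (g k) -> K0 (f k).
Proof.
move=> fixK sep [H Hfg Hc2] k kfix gk.
have cH := homotopy_clip_continuous Hfg; have [_ H0 H1] := Hfg.
pose path t := H (k, clip t).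
have cpath : continuous path.
  apply: (@continuous_comp2 _ _ _ (fun t => (k, t)) _ _ cH).
  apply: continuous_pair; first exact: cst_continuous.
  exact: idfun_continuous.
have conn : connected (path @` `[0, 1]).
  apply: connected_continuous_connected; first exact: segment_connected.
  exact: continuous_subspaceT.
have sub : path @` `[0, 1] `<=` K0 `|` K1.
  move=> _ [t _ <-]; rewrite -fixK /Defs.fixset /= /path -Hc2 ?kfix//.
  exact: clip_itv.
have p0 : (path @` `[0, 1]) (f k).
  by exists 0; [rewrite /= in_itv /= lexx ler01|rewrite /path clip0].
have p1 : (path @` `[0, 1]) (g k).
  by exists 1; [rewrite /= in_itv /= lexx ler01|rewrite /path clip1].
have [sub0|sub1] := connected_subset sep sub conn; first exact: sub0.
have := separated_disjoint sep.
by rewrite -subset0 => /(_ _ (conj gk (sub1 _ p1))).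
Qed.

(** Compactness of [A] gives a uniform truncation; its invariance allows the lifts at [k] and [c2 k]
    to be compared. *)
Lemma transition_function (K : c2SpaceType) (A : set K) (s : K -> BU1 R) :
  contractible R K -> c2map s -> compact A -> (forall k, A k -> A (c2 k)) ->
  exists lam : K -> C, [/\ continuous lam,
    forall k, lam (c2 k) = (lam k)^*,
    forall k, A k -> lam k != 0,
    forall k, A k -> c2 k = k -> B0 R (s k) -> 0 < lam k &
    forall k, A k -> c2 k = k -> B1 R (s k) -> lam k < 0].
Proof.
move=> [x0 [H Hx0]] [cs sc2] cA Ac2.
have cH := homotopy_clip_continuous Hx0; have [_ H0 H1] := Hx0.
(* The contraction ends at [x0]; time is reversed so that all paths of lines start at [s x0]. *)
pose G (z : K * R) := s (H (z.1, clip (1 - z.2))).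
have cG : continuous G.
  apply: continuous_comp2 cs.
  apply: (@continuous_comp2 _ _ _ (fun z : K * R => (z.1, 1 - z.2)) _ _ cH).
  apply: continuous_pair; first exact: continuous_fst.
  by move=> z; apply: cvgB; [exact: cvg_cst|exact: cvg_snd].
have G0 x : G (x, 0) = s x0 by rewrite /G /= subr0 clip1 H1.
have G1 x : G (x, 1) = s x by rewrite /G /= subrr clip0 H0.
have [n [V [cV VP]]] := line_lifting cA cG G0.
have {VP} nV k : A k -> 0 < dot n (coord (rep (s k))) (coord (rep (s k))) /\
    exists2 c : C, c != 0 & forall b i, V k b i = c * coord (rep (s k)) b i.
  by move=> /VP; rewrite G1.
have Vdot k : A k -> 0 < dot n (V k) (V k).
  move=> /nV[n0 [c c0 Vk]].
  have -> : V k = fun b i => c * coord (rep (s k)) b i.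
    by apply/funext => b; apply/funext => i; exact: Vk.
  by rewrite dotZ mulr_gt0// -normCK exprn_gt0// normr_gt0.
(* The involution of the universe, in coordinates. *)
pose sg (w : bool -> nat -> C) b i := (-1) ^+ (~~ b) * w b i.
have sgJ w b i : (sg w b i)^* = (-1) ^+ (~~ b) * (w b i)^*.
  by rewrite /sg rmorphM rmorph_sign.
exists (fun k => dot n (V (c2 k)) (sg (V k))); split.
- apply: continuous_dot => b i.
    exact: continuous_comp2 (@c2_continuous K) (cV b i).
  by apply: continuous_mul; [exact: cst_continuous|exact: cV].
(* [sg] is self-adjoint, and exchanging [k] with [c2 k] swaps the arguments of the Hermitian
   product. *)
- move=> k; rewrite c2K /dot rmorph_sum; apply: eq_bigr => p _.
  rewrite sgJ /sg !rmorphM /= !rmorph_sign conjCK mulrCA mulrA; ring.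
- move=> k Ak; have [n0 [c c0 Vk]] := nV k Ak.
  have [_ [c' c'0 Vk']] := nV _ (Ac2 _ Ak).
  have [d d0 dE] := rep_c2 (s k).
  suff -> : dot n (V (c2 k)) (sg (V k)) =
      c' * d * c^* * dot n (coord (rep (s k))) (coord (rep (s k))).
    by rewrite !mulf_neq0 ?conjC_eq0// gt_eqF.
  rewrite /dot mulr_sumr; apply: eq_bigr => p _.
  rewrite sgJ Vk Vk' sc2 dE rmorphM /=.
  rewrite (_ : _ * _ = c' * d * c^* * ((-1) ^+ (~~ p.1) * (-1) ^+ (~~ p.1)) *
    (coord (rep (s k)) p.1 p.2 * (coord (rep (s k)) p.1 p.2)^*)); last by ring.
  by rewrite -expr2 sqrr_sign mulr1.
(* On [B0] the coordinates in the sign summand vanish, so [sg] fixes [V k]; on [B1], in the next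
   case, it negates [V k]. *)
- move=> k Ak kfix sB; rewrite kfix.
  suff -> : dot n (V k) (sg (V k)) = dot n (V k) (V k) by exact: Vdot.
  have [_ [c _ Vk]] := nV k Ak.
  apply: eq_bigr => p _; rewrite /sg; case: p.1; rewrite ?mul1r//.
  by rewrite Vk /coord (sB _ (rep_in _)) coef0 !(mulr0, mul0r).
- move=> k Ak kfix sB; rewrite kfix.
  suff -> : dot n (V k) (sg (V k)) = - dot n (V k) (V k).
    by rewrite oppr_lt0; exact: Vdot.
  have [_ [c _ Vk]] := nV k Ak.
  rewrite -sumrN; apply: eq_bigr => p _; rewrite /sg; case: p.1.
    by rewrite Vk /coord (sB _ (rep_in _)) coef0 !(mulr0, mul0r) oppr0.
  by rewrite expr1 mulN1r rmorphN mulrN.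
Qed.

(** * The test sphere *)

(* Joins 1 to -1 while avoiding 0. *)
Definition half_turn (y : R) : C := ((1 - 2 * y) +i* (y * (1 - y)))%C.

Lemma half_turn_neq0 y : half_turn y != 0.
Proof.
rewrite eq_complex /=; apply/negP => /andP[/eqP y1 /eqP y2].
have : y = 2^-1 by lra.
by move=> yE; move: y2; rewrite yE; lra.
Qed.

Lemma continuous_half_turn : continuous half_turn.
Proof.
have -> : half_turn = fun y => ((1 - 2 * y)%:C)%C + 'i%C * ((y * (1 - y))%:C)%C.
  by apply/funext => y; rewrite /half_turn [LHS]complexE.
have c1 (a : R) : continuous (fun y : R => 1 - a * y).
  move=> y; apply: cvgB; first exact: cvg_cst.
  by apply: cvgM; [exact: cvg_cst|exact: cvg_id].
have c2 : continuous (fun y : R => y * (1 - y)).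
  move=> y; apply: cvgM; first exact: cvg_id.
  by apply: cvgB; [exact: cvg_cst|exact: cvg_id].
have d1 := continuous_comp2 (c1 2) continuous_real_complex.
have d2 := continuous_comp2 c2 continuous_real_complex.
by move=> y; apply: cvgD; [exact: d1|apply: cvgM; [exact: cvg_cst|exact: d2]].
Qed.

(* The points with z.1 in [0, 1] and z.2 in [0, 1] sweep out half of the sphere
   of lines in C (+) C^sigma, from B0 at z.1 = 0 to B1 at z.1 = 1. *)
Definition sphere_vector (z : R * R) : U :=
  @universe_incl R 1 (const_mx ((1 - z.1)%:C)%C,
                      const_mx (((z.1)%:C)%C * half_turn z.2)).

Lemma sphere_vectorE z : sphere_vector z =
  ((((1 - z.1)%:C)%C)%:P, (((z.1)%:C)%C * half_turn z.2)%:P).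
Proof.
have E (c : C) : rVpoly (const_mx c : 'rV_1) = c%:P.
  apply/polyP => -[|i]; rewrite coefC ?(coef_rVpoly_ord _ ord0) ?mxE//=.
  by rewrite nth_default// (leq_trans (size_poly _ _)).
by rewrite /sphere_vector /universe_incl !E.
Qed.

Lemma sphere_vector_neq0 z : sphere_vector z != 0.
Proof.
rewrite sphere_vectorE; apply/eqP => -[/eqP + /eqP].
rewrite !polyC_eq0 mulf_eq0 (negbTE (half_turn_neq0 _)) orbF.
rewrite !eq_complex /= eqxx !andbT.
by move=> /eqP z0 /eqP z1; move: z0; rewrite z1; lra.
Qed.

Lemma continuous_sphere_vector : continuous sphere_vector.
Proof.
apply: (@continuous_comp2 _ _ _ _ (@universe_incl R 1)); last first.
  exact: (@coinduced_continuous _ _ _ (@universe_incl R) 1).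
have c1 : continuous (fun z : R * R => 1 - z.1).
  by move=> y; apply: cvgB; [exact: cvg_cst|exact: cvg_fst].
apply: continuous_pair; apply: continuous_comp2 (@continuous_const_mx 1 1).
  exact: continuous_comp2 c1 continuous_real_complex.
apply: continuous_mul.
  exact: continuous_comp2 (@continuous_fst _ _) continuous_real_complex.
exact: continuous_comp2 (@continuous_snd _ _) continuous_half_turn.
Qed.

Definition sphere (z : R * R) : BU1 R :=
  line_of (exist _ (sphere_vector z) (mem_set (sphere_vector_neq0 z)) :
    @nonzero R).

Lemma continuous_sphere : continuous sphere.
Proof.
apply: (@continuous_comp2 _ (@nonzero R) _
  (fun z => exist _ (sphere_vector z) (mem_set (sphere_vector_neq0 z)))
  (@line_of R)).
  by apply: continuous_comp_initial; exact: continuous_sphere_vector.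
exact: (@coinduced_continuous _ _ _ (fun _ : unit => @line_of R) tt).
Qed.

(** [half_turn] takes opposite values at 0 and 1, which is the sign action on the second summand. *)
Lemma sphere_c2 x : sphere (x, 1) = c2 (sphere (x, 0)).
Proof.
apply: BU1_eq; rewrite /= image_c2_span1; congr span1.
suff : sphere_vector (x, 1) = universe_c2 (sphere_vector (x, 0)) by [].
rewrite !sphere_vectorE /universe_c2 /=; congr pair.
rewrite -polyCN; congr polyC; rewrite -mulrN; congr (_ * _).
apply/eqP; rewrite /half_turn eq_complex /=.
by apply/andP; split; apply/eqP; lra.
Qed.

Lemma sphere_B0 y : B0 R (sphere (0, y)).
Proof.
move=> _ [c _ <-]; suff : (c *: sphere_vector (0, y)).2 = 0 by [].
by rewrite sphere_vectorE /= mul0r polyC0 scaler0.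
Qed.

Lemma sphere_B1 y : B1 R (sphere (1, y)).
Proof.
move=> _ [c _ <-]; suff : (c *: sphere_vector (1, y)).1 = 0 by [].
by rewrite sphere_vectorE /= subrr polyC0 scaler0.
Qed.

End obstruction.

(** * The sign conflict on the square *)

Theorem proposition17p1 (R : realType) (K : c2SpaceType) (K0 K1 : set K)
    (hK : is_K2 R K0 K1)
    (p : BU1 R -> K) (p_c2 : c2map p)
    (p_B0 : p @` B0 R `<=` K0) (p_B1 : p @` B1 R `<=` K1) :
  ~ exists s : K -> BU1 R, c2map s /\ c2homotopic R (p \o s) idfun.
Proof.
move=> [s [s_c2 ps]]; have [_ Kcontr fixK sep _] := hK.
have [cp pc2] := p_c2.
pose k z := p (sphere z).
have ck : continuous k := continuous_comp2 (@continuous_sphere R) cp.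
pose Q := k @` (`[0, 1] `*` `[0, 1]).
have cQ : compact Q.
  apply: continuous_compact; first exact: continuous_subspaceT.
  by apply: compact_setX; exact: segment_compact.
(* Adding the image under the involution makes the compact set invariant. *)
pose A := Q `|` c2 @` Q.
have cA : compact A.
  apply: compactU => //; apply: continuous_compact => //.
  exact/continuous_subspaceT/c2_continuous.
have Ac2 x : A x -> A (c2 x).
  by case=> [Qx|[y Qy <-]]; [right; exists x|left; rewrite c2K].
have Ak x y : 0 <= x <= 1 -> 0 <= y <= 1 -> A (k (x, y)).
  by move=> x01 y01; left; exists (x, y) => //; split; rewrite /= in_itv.
have [lam [clam lamJ lam0 lamB0 lamB1]] :=
  transition_function Kcontr s_c2 cA Ac2.
have I0 : 0 <= (0 : R) <= 1 by rewrite lexx ler01.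
have I1 : 0 <= (1 : R) <= 1 by rewrite lexx ler01.
have fixB (L : BU1 R) : (B0 R `|` B1 R) L -> c2 L = L.
  by move=> BL; have : Defs.fixset (BU1 R) L by rewrite fixset_BU1.
have disj x : K0 x -> K1 x -> False.
  move=> x0 x1; have := separated_disjoint sep.
  by rewrite -subset0 => /(_ x (conj x0 x1)).
have sfix x : c2 x = x -> (B0 R `|` B1 R) (s x).
  by move=> xfix; rewrite -fixset_BU1 /Defs.fixset /= -(proj2 s_c2) xfix.
apply: (@no_sign_change R (fun z => lam (k z))).
- exact: continuous_comp2 ck clam.
- by move=> x y x01 y01; exact/lam0/Ak.
- move=> y y01.
  have kfix : c2 (k (0, y)) = k (0, y).
    by rewrite /k -pc2 fixB//; left; exact: sphere_B0.
  have kK0 : K0 (k (0, y)).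
    by apply: p_B0; exists (sphere (0, y)) => //; exact: sphere_B0.
  apply: lamB0 => //; first exact: Ak.
  (* Were this point sent to [B1], its image under [p \o s] would lie in [K1], whereas the homotopy
     to the identity keeps it in [K0]. *)
  case: (sfix _ kfix) => // sB1; exfalso.
  apply: (disj (p (s (k (0, y))))); last by apply: p_B1; exists (s (k (0, y))).
  exact: (c2homotopic_fixed_component fixK sep ps).
- move=> y y01.
  have kfix : c2 (k (1, y)) = k (1, y).
    by rewrite /k -pc2 fixB//; right; exact: sphere_B1.
  have kK1 : K1 (k (1, y)).
    by apply: p_B1; exists (sphere (1, y)) => //; exact: sphere_B1.
  apply: lamB1 => //; first exact: Ak.
  case: (sfix _ kfix) => // sB0; exfalso.
  apply: (disj (p (s (k (1, y))))); first by apply: p_B0; exists (s (k (1, y))).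
  rewrite setUC in fixK; rewrite separatedC in sep.
  exact: (c2homotopic_fixed_component fixK sep ps).
- by move=> x x01; rewrite -lamJ /k sphere_c2 pc2.
Qed.
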